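(* Let $k\ge 3$ and $s>2k$ be integers, and let $\eta>0$. Then there exists a number $c=c(k,s,\eta)>0$ such that for every $A\ge 1$, the number of $\mathbf a\in(\mathbb Z\setminus\{0\})^s$ with $|\mathbf a|\le A$ for which the equation $a_1x_1^k+\dots+a_sx_s^k=0$ admits an integral solution $\mathbf x\in\mathbb Z^s$ with $0<|\mathbf x|\le c|\mathbf a|^{1/(s-k)}$ does not exceed $\eta A^s$.
   Context: For $\mathbf x\in\mathbb R^s$ write $|\mathbf x|=\max_j|x_j|$. *)

(* Defs.v *)
From HB Require Import structures.
From mathcomp Require Import all_boot all_order all_algebra.
From mathcomp Require Import finmap zify.
From mathcomp Require Import all_classical all_reals exp.
Set Implicit Arguments.
Unset Strict Implicit.
Unset Printing Implicit Defensive.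
Import Order.TTheory GRing.Theory Num.Theory.
Local Open Scope classical_set_scope.
Local Open Scope ring_scope.

Definition maxnorm (s : nat) (x : 'rV[int]_s) : nat :=
  \max_(j < s) absz (x ord0 j).

Definition has_small_solution (R : realType) (k s : nat) (c : R)
    (a : 'rV[int]_s) : Prop :=
  exists x : 'rV[int]_s,
    [/\ \sum_(j < s) a ord0 j * x ord0 j ^+ k = 0,
        (0 < maxnorm x)%N
      & (maxnorm x)%:R <= c * (maxnorm a)%:R `^ (s%:R - k%:R)^-1].

Definition small_solution_coefs (R : realType) (k s : nat) (c A : R) :
    set 'rV[int]_s :=
  [set a : 'rV[int]_s | [/\ forall j, a ord0 j != 0,
               (maxnorm a)%:R <= A
             & has_small_solution k c a]].

(* [fset_set] returns the empty set on infinite sets, so finiteness is what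
   makes [#|` fset_set _ |] the actual number of elements. *)
Lemma finite_small_solution_coefs (R : realType) (k s : nat) (c A : R) :
  finite_set (@small_solution_coefs R k s c A).
Proof.
have [N AN] : exists N : nat, A <= N%:R.
  exists (Num.bound `|A|); apply: le_trans (ler_norm A) _.
  exact/ltW/(archi_boundP (normr_ge0 A)).
pose f (m : 'rV['I_(N + N).+1]_s) : 'rV[int]_s :=
  \row_j ((m ord0 j : nat)%:Z - N%:Z).
apply: (@sub_finite_set _ _ (f @` setT)); last exact/finite_image/finite_finset.
move=> a [_ /le_trans /(_ AN)]; rewrite ler_nat => aN _.
exists (\row_j inord (absz (a ord0 j + N%:Z))) => //.
apply/rowP => j; rewrite !mxE -[a 0 j]/(a ord0 j).
have : (absz (a ord0 j) <= N)%N.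
  by apply: leq_trans aN; rewrite /maxnorm (leq_bigmax j).
by move: (a ord0 j) => z zN; rewrite inordK; lia.
Qed.

(* Main.v *)
Require Import Defs.
From HB Require Import structures.
From mathcomp Require Import all_boot all_order all_algebra.
From mathcomp Require Import finmap.
From mathcomp Require Import all_classical all_reals exp.
From mathcomp Require Import zify.
Import Order.TTheory GRing.Theory Num.Theory.
Local Open Scope classical_set_scope.
Local Open Scope ring_scope.

(** If [a] has a small solution it has a primitive one, so it is enough to
    count, for each primitive [x] with [X = |x|], the vectors [a] of the box [|a| <= N]
    orthogonal to [b = (x_1^k, ..., x_s^k)].  As [b] is primitive and
    [|b| = X^k <= N] (here [s > 2k] enters), every [0 <= t < X^k N] is [w . b]
    for some [w] of size [O(N)], and the translates of the set of these [a] by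
    the various [w] are disjoint; hence there are [O(N^(s-1) / X^k)] such [a].
    Summing over the [O(X^(s-1))] vectors [x] of norm [X] and over
    [X <= M = c A^(1/(s-k))] gives
    [O(N^(s-1) M^(s-k)) = O(c^(s-k) A^s)]. *)

(** * The maximum norm and elementary counting *)

Lemma maxnorm_leP {s : nat} (x : 'rV[int]_s) (N : nat) :
  reflect (forall j, (absz (x ord0 j) <= N)%N) (maxnorm x <= N)%N.
Proof.
apply: (iffP (bigmax_leqP _ _ _)) => [h j|h j _]; first exact: h.
exact: h.
Qed.

Lemma absz_le_maxnorm {s : nat} (x : 'rV[int]_s) j :
  (absz (x ord0 j) <= maxnorm x)%N.
Proof. exact/maxnorm_leP. Qed.

Lemma maxnorm_attained {s : nat} (x : 'rV[int]_s) :
  (0 < s)%N -> exists j, maxnorm x = absz (x ord0 j).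
Proof.
move=> s0; have [|j xj] := @bigop.eq_bigmax 'I_s (fun j => absz (x ord0 j)).
  by rewrite card_ord.
by exists j.
Qed.

Lemma maxnormD {s : nat} (x y : 'rV[int]_s) :
  (maxnorm (x + y) <= maxnorm x + maxnorm y)%N.
Proof.
apply/maxnorm_leP => j; rewrite mxE.
have := absz_le_maxnorm x j; have := absz_le_maxnorm y j.
by move: (x ord0 j) (y ord0 j) => u v; lia.
Qed.

Lemma leq_expn_base (m n e : nat) : (m <= n)%N -> (m ^ e <= n ^ e)%N.
Proof. by case: e => // e mn; rewrite leq_exp2r. Qed.

Lemma leq_card_inj {T U : choiceType} (f : T -> U) (r : seq T)
    (B : {fset U}) :
  uniq r -> {in r &, injective f} -> (forall x, x \in r -> f x \in B) ->
  (size r <= #|` B|)%N.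
Proof.
move=> r_uniq f_inj fr; rewrite -(size_map f r); apply: uniq_leq_size.
  by rewrite map_inj_in_uniq.
by move=> _ /mapP[x xr ->]; exact: fr.
Qed.

Lemma leq_card_cover {T I : choiceType} (S : {fset T}) (r : seq I)
    (F : I -> {fset T}) :
  (forall a, a \in S -> exists2 i, i \in r & a \in F i) ->
  (#|` S| <= \sum_(i <- r) #|` F i|)%N.
Proof.
elim: r S => [|i r IHr] S cov.
  rewrite big_nil leqn0 cardfs_eq0; apply/eqP/fsetP => a.
  by rewrite inE; apply/negP => /cov[].
rewrite big_cons -(cardfsID (F i) S); apply: leq_add.
  exact/fsubset_leq_card/fsubsetIr.
apply: IHr => a; rewrite inE => /andP[aFi /cov[j]].
rewrite inE => /predU1P[-> aF|jr aF]; first by rewrite aF in aFi.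
by exists j.
Qed.

(** * Integer points in boxes and on spheres *)

Definition shifted_row (s N : nat) (m : 'rV['I_(N + N).+1]_s) : 'rV[int]_s :=
  \row_j ((m ord0 j : nat)%:Z - N%:Z).

(** Built as the image of a finite type of matrices, so that finiteness is automatic and, the shift
    by [N] being injective, the cardinality is that of the type. *)
Definition box (s N : nat) : {fset 'rV[int]_s} :=
  [fset shifted_row s N m | m in [set: 'rV['I_(N + N).+1]_s]%SET]%fset.

Lemma in_box (s N : nat) (x : 'rV[int]_s) :
  (x \in box s N) = (maxnorm x <= N)%N.
Proof.
apply/imfsetP/maxnorm_leP => [[m _ ->] j|xN].
  by rewrite mxE; case: (m ord0 j) => i /= iN; lia.
exists (\row_j inord (absz (x ord0 j + N%:Z))); first by rewrite /= inE.
apply/rowP => j; rewrite !mxE -[x 0 j]/(x ord0 j).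
by have := xN j; move: (x ord0 j) => z zN; rewrite inordK; lia.
Qed.

Lemma card_box (s N : nat) : #|` box s N| = ((N + N).+1 ^ s)%N.
Proof.
rewrite card_imfset /=; last first.
  move=> m n /rowP mn; apply/rowP => j; have := mn j; rewrite !mxE.
  by move=> /addIr [] /val_inj.
by rewrite -cardE cardsT card_mx card_ord mul1n.
Qed.

Definition sphere (s X : nat) : {fset 'rV[int]_s} :=
  [fset x in box s X | maxnorm x == X]%fset.

(** Deleting the fixed coordinate is injective on the slice and lands in the box of one dimension
    less. *)
Lemma card_box_slice (s X : nat) (j : 'I_s.+1) (v : int) :
  (#|` [fset x in box s.+1 X | x ord0 j == v]%fset| <= (X + X).+1 ^ s)%N.
Proof.
rewrite -card_box; apply: (@leq_card_inj _ _ (@col' _ _ _ j)) => [|x y|x].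
- exact: fset_uniq.
- rewrite !inE => /andP[_ /eqP xv] /andP[_ /eqP yv] /rowP xy.
  apply/rowP => i; case: (unliftP j i) => [i' ->|->]; last by rewrite xv yv.
  by have := xy i'; rewrite !mxE.
- rewrite !inE !in_box => /andP[/maxnorm_leP xX _].
  by apply/maxnorm_leP => i; rewrite mxE; exact: xX.
Qed.

(** Some coordinate of a vector of norm [X] equals [X] or [-X], so [s * 2] slices of the box cover
    the sphere. *)
Lemma card_sphere (s X : nat) : (0 < s)%N ->
  (#|` sphere s X| <= (s * 2) * (X + X).+1 ^ s.-1)%N.
Proof.
case: s => // s _ /=.
pose F (p : 'I_s.+1 * bool) : {fset 'rV[int]_s.+1} :=
  [fset x in box s.+1 X | x ord0 p.1 == (-1) ^+ p.2 * X%:Z]%fset.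
apply: (@leq_trans (\sum_(p <- enum {: 'I_s.+1 * bool}) #|` F p|)).
  apply: leq_card_cover => x; rewrite !inE => /andP[xX /eqP xE].
  have [j jE] := maxnorm_attained x isT.
  exists (j, x ord0 j < 0); first by rewrite mem_enum.
  rewrite !inE xX /=; apply/eqP; rewrite -{}xE {}jE.
  exact: intEsign.
apply: (@leq_trans (\sum_(p <- enum {: 'I_s.+1 * bool}) (X + X).+1 ^ s)).
  by apply: leq_sum => p _; exact: card_box_slice.
rewrite big_const_seq iter_addn_0 count_predT -cardE card_prod card_ord.
by rewrite card_bool mulnC.
Qed.

(** * Counting the vectors orthogonal to a primitive vector *)

Lemma bezout_family (s : nat) (b : 'I_s -> int) :
  exists u : 'I_s -> int,
    \sum_j u j * b j = (\big[gcdn/0%N]_j absz (b j))%:Z.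
Proof.
(* Only the gcd is restricted to the list [r]; the combination keeps all indices, so that the
   induction can update [u] as a whole. *)
suff gen (r : seq 'I_s) : exists u : 'I_s -> int,
    \sum_j u j * b j = (\big[gcdn/0%N]_(j <- r) absz (b j))%:Z by exact: gen.
elim: r => [|j r [u uE]].
  exists (fun=> 0); rewrite big_nil; apply: big1 => j _; exact: mul0r.
rewrite big_cons; set g := (\big[_/_]_(_ <- _) _)%N in uE *.
have [p [q pq]] := Bezoutz (b j) g%:Z.
exists (fun i => q * u i + (if i == j then p else 0)).
under eq_bigr do rewrite mulrDl -mulrA.
rewrite big_split /= -mulr_sumr uE (bigD1 j) //= eqxx big1 => [|i /negPf->].
  by rewrite addr0 addrC pq.
exact: mul0r.
Qed.

(* Reduce [t u_i] modulo the largest coefficient for all other indices; the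
   remaining coordinate is then forced to be small as well. *)
Lemma small_representation (s N t : nat) (b u : 'I_s -> int) (j0 : 'I_s) :
  \sum_j u j * b j = 1 -> (forall j, (absz (b j) <= absz (b j0))%N) ->
  (0 < absz (b j0) <= N)%N -> (t < absz (b j0) * N)%N ->
  exists w : 'rV[int]_s,
    \sum_j w ord0 j * b j = t%:Z /\ (maxnorm w <= s.+1 * N)%N.
Proof.
move=> uE bmax /andP[q0 qN] tq.
have bj0 : b j0 != 0 by lia.
pose v j := t%:Z * u j.
pose w j := if j == j0 then v j0 + \sum_(i | i != j0) (v i %/ b j0)%Z * b i
            else (v j %% b j0)%Z.
have wE : \sum_j w j * b j = t%:Z.
  rewrite (bigD1 j0) //= {1}/w eqxx mulrDl mulr_suml -addrA -big_split /=.
  rewrite -[RHS]mulr1 -uE mulr_sumr [RHS](bigD1 j0) //= mulrA; congr (_ + _).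
  apply: eq_bigr => i /negPf ij0; rewrite /w ij0 mulrAC -mulrDl.
  by rewrite -divz_eq mulrA.
have wsmall j : j != j0 -> `|w j| <= `|b j0|.
  move=> /negPf jj0; rewrite /w jj0 ger0_norm ?modz_ge0//.
  exact/ltW/ltz_mod.
exists (\row_j w j); split; first by under eq_bigr do rewrite mxE.
apply/maxnorm_leP => j; rewrite mxE.
have [->|/wsmall] := eqVneq j j0; last by nia.
(* Each of the other terms [w i * b i] is at most [N] times [|b j0|], because [|w i| <= |b j0| <= N]
   and [|b i| <= |b j0|]. As [t] obeys the same bound, dividing by [|b j0|] leaves [s.+1 * N]. *)
have : `|w j0 * b j0| <= t%:Z + \sum_(i < s) N%:Z * `|b j0|.
  have -> : w j0 * b j0 = t%:Z - \sum_(i | i != j0) w i * b i.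
    by rewrite -wE [in RHS](bigD1 j0) //= addrK.
  apply: le_trans (ler_normB _ _) _; apply: lerD; first by lia.
  apply: le_trans (ler_norm_sum _ _ _) _.
  rewrite [leRHS](bigD1 j0) //= -[leLHS]add0r; apply: lerD; first by lia.
  apply: ler_sum => i ij0; rewrite normrM; apply: ler_pM => //.
    by apply: le_trans (wsmall _ ij0) _; lia.
  by have := bmax i; lia.
rewrite sumr_const card_ord normrM -mulr_natr => wb.
have : (absz (w j0) * absz (b j0) <= (s.+1 * N) * absz (b j0))%N by nia.
by rewrite leq_pmul2r.
Qed.

Definition annihilator {s : nat} (N : nat) (b : 'I_s -> int) :
    {fset 'rV[int]_s} :=
  [fset a in box s N | \sum_j a ord0 j * b j == 0]%fset.

(** A packing argument: if [w t] represents [t], then the form with coefficients [b] takes the value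
    [t] on the whole translate of the annihilator by [w t]. These [|b j0| * N] translates are
    therefore disjoint, and they share one box. *)
Lemma card_annihilator (s N : nat) (b : 'I_s -> int) (j0 : 'I_s) :
  \big[gcdn/0%N]_j absz (b j) = 1%N ->
  (forall j, (absz (b j) <= absz (b j0))%N) ->
  (0 < absz (b j0) <= N)%N ->
  (#|` annihilator N b| * (absz (b j0) * N) <= ((s + s + 5) * N) ^ s)%N.
Proof.
move=> gb bmax qN; set q := absz (b j0) in bmax qN *.
have [u] := bezout_family s b; rewrite gb => uE.
have rep (t : 'I_(q * N)) : exists w : 'rV[int]_s,
    \sum_j w ord0 j * b j = t%:Z /\ (maxnorm w <= s.+1 * N)%N.
  exact: (small_representation _ _ _ b u j0).
have [w wP] := choice rep.
pose D := [seq (a, t) | a <- annihilator N b : seq _, t <- enum 'I_(q * N)].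
have memD a t : (a, t) \in D -> a \in annihilator N b.
  by case/allpairsP => -[a' t'] /= [? _ [-> _]].
have DE : size D = (#|` annihilator N b| * (q * N))%N.
  by rewrite size_allpairs -cardE card_ord.
(* The radius is [N] for the annihilator plus [s.+1 * N] for the translation; the side
   [2 * s.+2 * N + 1] is at most [(s + s + 5) * N] since [N] is positive. *)
rewrite -DE; apply: (@leq_trans #|` box s (s.+2 * N)|); last first.
  by rewrite card_box; apply: leq_expn_base; nia.
apply: (@leq_card_inj _ _ (fun p => p.1 + w p.2)) => [|[a t] [a' t']|[a t]].
- by apply: allpairs_uniq => [||[? ?] [? ?]]; rewrite ?fset_uniq ?enum_uniq.
- move=> /memD + /memD; rewrite !inE /= => /andP[_ /eqP aE] /andP[_ /eqP aE'].
  move=> eq_aw.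
  have aw (x : 'rV[int]_s) r : \sum_j x ord0 j * b j = 0 ->
      \sum_j (x + w r) ord0 j * b j = r%:Z.
    move=> xE; under eq_bigr do rewrite mxE mulrDl.
    by rewrite big_split /= xE add0r (wP r).1.
  have tt' : t = t'.
    by apply/val_inj; have := aw _ t aE; rewrite eq_aw aw // => -[].
  by move: eq_aw; rewrite tt' => /addIr ->.
- move=> /memD; rewrite !inE !in_box /= => /andP[aN _].
  by apply: leq_trans (maxnormD _ _) _; have := (wP t).2; lia.
Qed.

(** * Primitive vectors *)

Definition primitive {s : nat} (x : 'rV[int]_s) : bool :=
  \big[gcdn/0%N]_j absz (x ord0 j) == 1%N.

(** A prime dividing every [k]-th power divides every coordinate. *)
Lemma primitive_exp {s : nat} (k : nat) (x : 'rV[int]_s) :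
  primitive x -> \big[gcdn/0%N]_j absz (x ord0 j ^+ k) = 1%N.
Proof.
move=> /eqP px; set g := \big[_/_]_j _.
have [//|g1] := eqVneq g 1%N.
have [p p_prime /dvdn_biggcdP pg] : exists2 p, prime p & (p %| g)%N.
  (* Every prime divides a zero gcd, so [2] serves there. *)
  have [->|g0] := posnP g; first by exists 2%N.
  have /pdivP[p ? ?] : (1 < g)%N by lia.
  by exists p.
suff : (p %| 1)%N by rewrite dvdn1 => /eqP p1; rewrite p1 in p_prime.
rewrite -px; apply/dvdn_biggcdP => j _; have := pg j isT.
by rewrite abszX Euclid_dvdX // => /andP[].
Qed.

Lemma primitive_part {s : nat} (x : 'rV[int]_s) : (0 < maxnorm x)%N ->
  exists g (y : 'rV[int]_s), [/\ (0 < g)%N, primitive y & x = g%:Z *: y].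
Proof.
move=> x0; pose g := \big[gcdn/0%N]_j absz (x ord0 j).
have gx j : (g %| absz (x ord0 j))%N by exact: (biggcdn_inf j).
have g0 : (0 < g)%N.
  rewrite lt0n; apply: contraL x0 => /eqP g0; rewrite -leqNgt.
  by apply/maxnorm_leP => j; have := gx j; rewrite g0 dvd0n => /eqP ->.
pose y := \row_j (x ord0 j %/ g%:Z)%Z.
have xE : x = g%:Z *: y.
  by apply/rowP => j; rewrite !mxE mulrC divzK // dvdzE; exact: gx.
exists g, y; split => //; rewrite /primitive; set h := \big[_/_]_j _.
(* If [h] divides all coordinates of [y], then [g * h] divides all those of [x], hence their gcd
   [g]; this forces [h = 1]. *)
have : (g * h %| g)%N.
  apply/dvdn_biggcdP => j _; rewrite xE mxE abszM dvdn_mul //.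
  exact: (biggcdn_inf j).
by rewrite -{2}[g]muln1 dvdn_pmul2l // dvdn1.
Qed.

(** * Counting coefficient vectors by the norm of a primitive solution *)

Definition layer (k s N X : nat) : {fset 'rV[int]_s} :=
  [fset a in box s N |
    has (fun x : 'rV[int]_s => primitive x &&
           (\sum_j a ord0 j * x ord0 j ^+ k == 0)) (sphere s X)]%fset.

Lemma card_layer (k s N X : nat) :
  (k < s)%N -> (0 < X)%N -> (X ^ k <= N)%N ->
  (#|` layer k s N X| <=
     s * 2 * 3 ^ s.-1 * (s + s + 5) ^ s * X ^ (s.-1 - k) * N ^ s.-1)%N.
Proof.
move=> ks X0 XN; have s0 : (0 < s)%N by lia.
have Xk0 : (0 < X ^ k)%N by rewrite expn_gt0 X0.
have N0 : (0 < N)%N by lia.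
pose r := [seq x <- sphere s X | primitive x].
have layer_cover : (#|` layer k s N X| <=
    \sum_(x <- r) #|` annihilator N (fun j => x ord0 j ^+ k)|)%N.
  apply: leq_card_cover => a; rewrite !inE.
  move=> /andP[aN /hasP[x xX /andP[px ax]]].
  by exists x; [rewrite mem_filter px | rewrite !inE aN].
(* The annihilator bound is stated without division, so both sides are first multiplied by
   [X ^ k * N]. *)
rewrite -(@leq_pmul2r (X ^ k * N)) ?muln_gt0 ?Xk0 //.
apply: leq_trans (leq_mul layer_cover (leqnn _)) _; rewrite big_distrl /=.
apply: (@leq_trans (\sum_(x <- r) ((s + s + 5) * N) ^ s)).
  rewrite !big_seq; apply: leq_sum => x.
  rewrite mem_filter !inE => /andP[px /andP[_ /eqP xX]].
  have [j jE] := maxnorm_attained x s0.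
  have <- : absz (x ord0 j ^+ k) = (X ^ k)%N by rewrite abszX -jE xX.
  apply: card_annihilator; first exact: primitive_exp.
    by move=> i; rewrite !abszX leq_expn_base // -jE absz_le_maxnorm.
  by rewrite abszX -jE xX Xk0.
rewrite big_const_seq iter_addn_0 count_predT.
have size_r : (size r <= s * 2 * (3 * X) ^ s.-1)%N.
  rewrite size_filter; apply: leq_trans (count_size _ _) _.
  apply: leq_trans (card_sphere s X s0) _.
  by rewrite leq_mul2l; apply/orP; right; apply: leq_expn_base; lia.
rewrite mulnC; apply: leq_trans (leq_mul size_r (leqnn _)) _.
(* The exponent splits because [k <= s.-1]; the factor [X ^ k] then cancels the one introduced
   above. *)
have XE : (X ^ s.-1 = X ^ (s.-1 - k) * X ^ k)%N.
  by rewrite -expnD subnK //; lia.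
have NE : (N ^ s = N ^ s.-1 * N)%N by rewrite -expnSr prednK.
by rewrite !expnMn XE NE; apply/eq_leq; lia.
Qed.

(** Each of the [M] layers is bounded by the estimate at [X = M], which supplies one more factor
    [M]. *)
Lemma card_layers (k s N M : nat) (S : {fset 'rV[int]_s}) :
  (k < s)%N -> (M ^ k <= N)%N ->
  (forall a, a \in S -> exists2 X, (0 < X <= M)%N & a \in layer k s N X) ->
  (#|` S| <= s * 2 * 3 ^ s.-1 * (s + s + 5) ^ s * M ^ (s - k) * N ^ s.-1)%N.
Proof.
move=> ks MN cov.
apply: (@leq_trans (\sum_(X <- iota 1 M) #|` layer k s N X|)).
  apply: leq_card_cover => a /cov[X XM aX].
  by exists X => //; rewrite mem_iota; lia.
set C := (s * 2 * 3 ^ s.-1 * (s + s + 5) ^ s)%N.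
apply: (@leq_trans (\sum_(X <- iota 1 M) C * M ^ (s.-1 - k) * N ^ s.-1)).
  rewrite !big_seq; apply: leq_sum => X; rewrite mem_iota => /andP[X0 XM].
  have XM' : (X <= M)%N by lia.
  apply: leq_trans (card_layer _ _ _ _ ks X0 _) _.
    exact: leq_trans (leq_expn_base _ _ k XM') MN.
  by rewrite leq_mul2r leq_mul2l leq_expn_base ?orbT.
rewrite big_const_seq iter_addn_0 count_predT size_iota.
have -> : (s - k = (s.-1 - k).+1)%N by lia.
by rewrite expnSr; apply/eq_leq; lia.
Qed.

(** Dividing a solution by the gcd of its coordinates keeps the equation and does not increase the
    norm. Norms are integers, so real bounds on them may be truncated. *)
Lemma small_solution_layer (R : realType) (k s N M : nat) (c A : R)
    (a : 'rV[int]_s) :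
  (k < s)%N -> 0 <= c -> 1 <= A -> N = Num.trunc A ->
  M = Num.trunc (c * A `^ (s%:R - k%:R)^-1) ->
  a \in small_solution_coefs k c A ->
  exists2 X, (0 < X <= M)%N & a \in layer k s N X.
Proof.
move=> ks c0 A1 -> ->; rewrite inE => -[_ aA [x [ax x0 xc]]].
have A0 : 0 <= A by exact: le_trans A1.
have [g [y [g0 py xE]]] := primitive_part _ x0.
have nxE : maxnorm x = (g * maxnorm y)%N.
  have s0 : (0 < s)%N by lia.
  have [i iE] := maxnorm_attained y s0.
  apply/eqP; rewrite eqn_leq; apply/andP; split.
    apply/maxnorm_leP => j; rewrite xE mxE abszM leq_mul2l.
    by rewrite absz_le_maxnorm orbT.
  by have := absz_le_maxnorm x i; rewrite {1}xE mxE abszM iE.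
exists (maxnorm y).
  rewrite truncn_ge_nat ?mulr_ge0 ?powR_ge0 //; apply/andP; split; first by nia.
  apply: (@le_trans _ _ (maxnorm x)%:R); first by rewrite ler_nat nxE; nia.
  apply: le_trans xc _; apply: ler_wpM2l => //.
  apply: ge0_ler_powR; rewrite ?nnegrE ?invr_ge0 ?subr_ge0 ?ler_nat //; lia.
rewrite !inE in_box truncn_ge_nat // aA /=; apply/hasP; exists y.
  by rewrite !inE in_box leqnn eqxx.
rewrite py /=; move: ax; rewrite xE.
under [X in X = 0 -> _]eq_bigr do rewrite mxE exprMn mulrCA.
by rewrite -mulr_sumr => /eqP; rewrite mulf_eq0 expf_eq0 => /orP[|//]; lia.
Qed.

Theorem theorem1p4 (R : realType) (k s : nat) (hk : (3 <= k)%N)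
    (hs : (2 * k < s)%N) (eta : R) (heta : 0 < eta) :
  exists c : R, 0 < c /\
    forall A : R, 1 <= A ->
      #|` fset_set (@small_solution_coefs R k s c A)|%:R <= eta * A ^+ s.
Proof.
have ks : (k < s)%N by lia.
pose C := (s * 2 * 3 ^ s.-1 * (s + s + 5) ^ s)%N.
have C0 : 0 < C%:R :> R by rewrite ltr0n !muln_gt0 !expn_gt0 /=; lia.
(* The bound [eta / C] serves the final estimate; the bound [1] gives [c ^+ (s - k) <= c] and
   [c * A <= A]. *)
pose c := Num.min 1 (eta / C%:R).
have c0 : 0 < c by rewrite lt_min ltr01 divr_gt0.
have c1 : c <= 1 by rewrite ge_min lexx.
have cC : C%:R * c <= eta by rewrite mulrC -ler_pdivlMr // ge_min lexx orbT.
exists c; split => // A A1.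
have A0 : 0 <= A by exact: le_trans A1.
pose N := Num.trunc A; pose M := Num.trunc (c * A `^ (s%:R - k%:R)^-1).
have NA : N%:R <= A by case/andP: (truncn_itv A0).
have MA : M%:R ^+ (s - k) <= c * A.
  have B0 : 0 <= c * A `^ (s%:R - k%:R)^-1 by rewrite mulr_ge0 ?powR_ge0 // ltW.
  have /andP[MB _] := truncn_itv B0.
  apply: (@le_trans _ _ ((c * A `^ (s%:R - k%:R)^-1) ^+ (s - k))).
    by rewrite lerXn2r ?nnegrE.
  rewrite exprMn -[X in _ * X]powR_mulrn ?powR_ge0 // -powRrM natrB 1?ltnW //.
  rewrite mulVf ?subr_eq0 ?eqr_nat; last by lia.
  rewrite powRr1 //; apply: ler_wpM2r => //.
  have -> : (s - k = (s - k).-1.+1)%N by lia.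
  rewrite exprS ler_piMr ?(ltW c0) //; apply: exprn_ile1 => //; exact: ltW.
(* Here [s > 2k] enters: [k <= s - k] gives [M ^ k <= M ^ (s - k) <= c * A <= A] for positive [M].
   For [M = 0] the left side vanishes because [k] is positive. *)
have MN : (M ^ k <= N)%N.
  rewrite truncn_ge_nat // natrX.
  case: (posnP M) => [->|M0].
    by rewrite expr0n (_ : (k == 0)%N = false) //; lia.
  apply: (@le_trans _ _ (M%:R ^+ (s - k))).
    by apply: ler_weXn2l; [rewrite ler1n | lia].
  by apply: le_trans MA _; rewrite ler_piMl.
apply: (@le_trans _ _ (C * M ^ (s - k) * N ^ s.-1)%:R).
  rewrite ler_nat; apply: card_layers => // a.
  rewrite in_fset_set; last exact: finite_small_solution_coefs.
  exact: small_solution_layer (ltW c0) A1 erefl erefl.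
(* One factor [A] is split off [A ^+ s] to absorb [C * M ^ (s - k)], which is at most
   [C * c * A <= eta * A]; the rest bounds [N ^ s.-1]. *)
rewrite 2!natrM !natrX -[in leRHS](@prednK s); last by lia.
rewrite exprS mulrA; apply: ler_pM; rewrite ?mulr_ge0 ?exprn_ge0 //; first last.
  by rewrite lerXn2r ?nnegrE.
apply: le_trans (ler_wpM2l _ MA) _ => //.
by rewrite mulrA; apply: ler_wpM2r.
Qed.
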